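(* Let $k$ be a $c_0$-universal kernel on $\mathbb{X}$. Let $\tilde P_1,\tilde P_2$ be random probability measures on $\mathbb{X}$, defined on the same probability space, such that for $i=1,2$, $\tilde P_i$ is almost surely discrete and its mean measure $\mathbb{E}[\tilde P_i]$ is atomless. Then $\mathrm{Corr}_k(\tilde P_1,\tilde P_2)=1$ if and only if $\tilde P_1=\tilde P_2$ almost surely.
   Context: $\mathbb{X}$ is a locally compact Polish space with Borel $\sigma$-algebra $\mathcal{X}$. $\mathcal{M}_b(\mathbb{X})$ is the space of bounded (finite) signed measures on $\mathbb{X}$ and $\mathcal{P}(\mathbb{X})$ the subset of probability measures, both with the $\sigma$-algebra generated by the evaluation maps $\xi\mapsto\xi(A)$, $A\in\mathcal{X}$. A kernel on $\mathbb{X}$ is a measurable function $k:\mathbb{X}\times\mathbb{X}\to\mathbb{R}$ that is bounded, symmetric and positive-definite ($\sum_{i,j=1}^m a_ia_jk(x_i,x_j)\ge 0$ for all $m$, $x_i\in\mathbb{X}$, $a_i\in\mathbb{R}$). $\mathbb{H}_k$ is its reproducing kernel Hilbert space. The kernel mean embedding of $\xi\in\mathcal{M}_b(\mathbb{X})$ is $\mu_k(\xi)\in\mathbb{H}_k$, $\mu_k(\xi)(y)=\int k(x,y)\,d\xi(x)$; it satisfies $\langle\mu_k(\xi_1),\mu_k(\xi_2)\rangle_{\mathbb{H}_k}=\iint k\,d\xi_1\,d\xi_2$. A kernel is $c_0$ if it vanishes at infinity, i.e. $\{x:|k(x,y)|\ge\varepsilon\}$ is compact for all $\varepsilon>0$,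 $y\in\mathbb{X}$. A $c_0$-kernel is $c_0$-universal if $\mu_k$ is injective on $\mathcal{M}_b(\mathbb{X})$ (equivalently, $\mathbb{H}_k$ is dense in $C_0(\mathbb{X})$ for the uniform norm). A random probability $\tilde P$ is a random element of $\mathcal{P}(\mathbb{X})$; its mean measure $\mathbb{E}[\tilde P]$ is the probability measure with $\int f\,d\mathbb{E}[\tilde P]=\mathbb{E}[\int f\,d\tilde P]$ for all bounded measurable $f$. The kernel covariance is $\mathrm{Cov}_k(\tilde P_1,\tilde P_2)=\mathbb{E}\big[\langle\mu_k(\tilde P_1)-\mathbb{E}[\mu_k(\tilde P_1)],\mu_k(\tilde P_2)-\mathbb{E}[\mu_k(\tilde P_2)]\rangle_{\mathbb{H}_k}\big]$, where the expectation of an $\mathbb{H}_k$-valued random element $V$ is characterised by $\langle h,\mathbb{E}[V]\rangle=\mathbb{E}\langle h,V\rangle$ for all $h\in\mathbb{H}_k$. $\mathrm{Var}_k(\tilde P)=\mathrm{Cov}_k(\tilde P,\tilde P)$, and when both kernel variances are positive, $\mathrm{Corr}_k(\tilde P_1,\tilde P_2)=\mathrm{Cov}_k(\tilde P_1,\tilde P_2)/\big(\sqrt{\mathrm{Var}_k(\tilde P_1)}\sqrt{\mathrm{Var}_k(\tilde P_2)}\big)$. *)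

(* Defs.v *)
From HB Require Import structures.
From mathcomp Require Import all_boot all_order all_algebra.
From mathcomp Require Import all_classical all_reals all_analysis.
From mathcomp Require Import measurable_realfun measurable_structure.
From mathcomp Require Import random_variable giry.

Set Implicit Arguments.
Unset Strict Implicit.
Unset Printing Implicit Defensive.

Import Order.TTheory GRing.Theory Num.Theory.
Import numFieldNormedType.Exports.

Local Open Scope classical_set_scope.
Local Open Scope ring_scope.

Notation borel X := (g_sigma_algebraType (@open X)).

Definition separable (X : topologicalType) : Prop :=
  exists2 D : set X, countable D & dense D.

(* X carries a complete pseudometric, which is a metric when X is Hausdorff.
   The results only involve the topology, so that quantifying over
   completePseudoMetricType amounts to choosing one complete compatible
   metric. *)
Definition polish {R : realType} (X : completePseudoMetricType R) : Prop :=
  hausdorff_space X /\ separable X.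

Section measures.
Context {d} {T : measurableType d} {R : realType}.

Definition discrete_measure (mu : {measure set T -> \bar R}) : Prop :=
  exists C : set T, [/\ countable C, measurable C & mu (~` C) = 0%E].

Definition is_atom (mu : {measure set T -> \bar R}) (A : set T) : Prop :=
  [/\ measurable A, (0 < mu A)%E &
      forall B, measurable B -> B `<=` A -> (mu B < mu A)%E -> mu B = 0%E].

Definition atomless (mu : {measure set T -> \bar R}) : Prop :=
  forall A, ~ is_atom mu A.

Lemma hahn_pair (nu : {charge set T -> \bar R}) :
  exists PN : set T * set T, hahn_decomposition nu PN.1 PN.2.
Proof. by have [P [N PN]] := Hahn_decomposition nu; exists (P, N). Qed.

(* Elements of M_b are charges, which are finite by definition; the integral
   does not depend on the Hahn decomposition chosen. *)
Definition charge_integral (nu : {charge set T -> \bar R}) (f : T -> R) : R :=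
  let PN := projT2 (cid (hahn_pair nu)) in
  \int[jordan_pos PN]_x f x - \int[jordan_neg PN]_x f x.

End measures.

(* A random probability is a random variable with values in pprobability, whose
   sigma-algebra, generated by the sets {mu | mu A < r}, is the one making the
   evaluation maps measurable. *)
Definition realization {d dT} {Omega : measurableType d}
    {T : measurableType dT} {R : realType}
    (P : {mfun Omega >-> pprobability T R}) (w : Omega) : probability T R := P w.

Section mean_measure.
Context {d dT} {Omega : measurableType d} {T : measurableType dT}
  {R : realType} (Pr : probability Omega R) (P : {RV Pr >-> pprobability T R}).
Local Open Scope ereal_scope.
Local Notation realization := (realization P).

Definition mean_measure (A : set T) : \bar R :=
  \int[Pr]_w realization w A.

Let measurable_ev (A : set T) : measurable A ->
  measurable_fun [set: Omega] (realization ^~ A).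
Proof. exact: (measurable_kernel (kprobability (@measurable_funPT _ _ _ _ P))). Qed.

Let mean_measure0 : mean_measure set0 = 0.
Proof. by rewrite /mean_measure integral0_eq. Qed.

Let mean_measure_ge0 A : 0 <= mean_measure A.
Proof. by rewrite /mean_measure integral_ge0. Qed.

Let mean_measure_sigma_additive : semi_sigma_additive mean_measure.
Proof.
move=> F mF tF mUF; rewrite [X in _ --> X](_ : _ =
    \sum_(0 <= n <oo) mean_measure (F n)).
  by apply: is_cvg_ereal_nneg_natsum => n _; exact: mean_measure_ge0.
rewrite /mean_measure -integral_nneseries//; last by move=> n; exact: measurable_ev.
apply: eq_integral => w _.
by apply/esym/cvg_lim => //; exact: measure_semi_sigma_additive.
Qed.

HB.instance Definition _ := isMeasure.Build _ _ _ mean_measure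
  mean_measure0 mean_measure_ge0 mean_measure_sigma_additive.

Let mean_measure_setT : mean_measure [set: T] = 1.
Proof.
rewrite /mean_measure (eq_integral (cst 1)); last first.
  by move=> w _; rewrite /= probability_setT.
by rewrite integral_cst//= probability_setT mul1e.
Qed.

HB.instance Definition _ := Measure_isProbability.Build _ _ _
  mean_measure mean_measure_setT.

Lemma ge0_integral_mean_measure (f : T -> \bar R) :
  measurable_fun [set: T] f -> (forall x, 0 <= f x) ->
  \int[mean_measure]_x f x = \int[Pr]_w \int[realization w]_x f x.
Proof.
move=> mf f0; pose l := kprobability (measurable_cst (Pr : pprobability Omega R)) : _.-pker unit ~> Omega.
pose k := kprobability (measurableT_comp (@measurable_funPT _ _ _ _ P)
      (@measurable_snd _ _ unit Omega)) : _.-pker (unit * Omega)%type ~> T.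
exact: (@integral_kcomp _ _ _ _ _ _ _ l k tt f f0 mf).
Qed.

Lemma integral_mean_measure (f : T -> R) :
  measurable_fun [set: T] f -> (exists M, forall x, (`|f x| <= M)%R) ->
  (\int[mean_measure]_x f x =
   fine 'E_Pr[fun w => \int[realization w]_x f x])%R.
Proof.
move=> mf [M fM]; rewrite unlock /Rintegral; congr fine.
have integrable_bounded d' (U : measurableType d') (Q : probability U R)
    (g : U -> \bar R) : measurable_fun [set: U] g ->
    (forall x, 0 <= g x) -> (forall x, g x <= M%:E) -> Q.-integrable setT g.
  move=> mg g0 gM; apply: (le_integrable measurableT mg (g := cst M%:E)).
    by move=> x _; rewrite gee0_abs//= (le_trans (gM x))// lee_fin ler_norm.
  exact: finite_measure_integrable_cst.
pose g := EFin \o f.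
have mg : measurable_fun [set: T] g by exact/measurable_EFinP.
have mp : measurable_fun [set: T] g^\+ by exact: measurable_funepos.
have mn : measurable_fun [set: T] g^\- by exact: measurable_funeneg.
have M0 : (0 <= M)%R by exact: le_trans (fM point).
have pM x : g^\+ x <= M%:E.
  by rewrite funeposE /g /= ge_max !lee_fin M0 (le_trans (ler_norm _)).
have nM x : g^\- x <= M%:E.
  by rewrite funenegE /g /= ge_max !lee_fin M0 andbT (le_trans (ler_norm _))// normrN.
have int_ge0 (h : T -> \bar R) (h0 : forall x, 0 <= h x) w :
    0 <= \int[realization w]_x h x by exact: integral_ge0.
have int_leM (h : T -> \bar R) : measurable_fun [set: T] h ->
    (forall x, 0 <= h x) -> (forall x, h x <= M%:E) ->
    forall w, \int[realization w]_x h x <= M%:E.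
  move=> mh h0 hM w; apply: (@le_trans _ _ (\int[realization w]_x (cst M%:E) x)).
    by apply: ge0_le_integral => //= x _; exact: hM.
  by rewrite integral_cst//= probability_setT mule1.
have int_meas (h : T -> \bar R) : measurable_fun [set: T] h ->
    (forall x, 0 <= h x) ->
    measurable_fun [set: Omega] (fun w => \int[realization w]_x h x).
  move=> mh h0; apply: (@measurable_fun_integral_kernel _ _ _ _ _
    (fun w => realization w : {measure set T -> \bar R})) => //.
rewrite integralE !ge0_integral_mean_measure//.
transitivity (\int[Pr]_w
  (\int[realization w]_x g^\+ x - \int[realization w]_x g^\- x)).
  apply/esym/(integralB measurableT).
    apply: (@integrable_bounded _ _ Pr _ (int_meas _ mp _)) => // w.
      exact: int_ge0.
    exact: int_leM.
  apply: (@integrable_bounded _ _ Pr _ (int_meas _ mn _)) => // w.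
    exact: int_ge0.
  exact: int_leM.
apply: eq_integral => w _; rewrite fineK; first by rewrite -integralE.
apply: (integrable_fin_num measurableT).
apply: (le_integrable measurableT mg (g := cst M%:E)).
  by move=> x _; rewrite /= lee_fin (le_trans (fM x))// ler_norm.
exact: finite_measure_integrable_cst.
Qed.

End mean_measure.
Arguments mean_measure {d dT Omega T R} Pr P.

Section kernel_embedding.
Context {R : realType} {X : completePseudoMetricType R}.
Implicit Types (k : X -> X -> R).

Definition is_kernel k : Prop :=
  [/\ measurable_fun [set: borel X * borel X]
        (fun z : borel X * borel X => k z.1 z.2),
      exists M, forall x y, `|k x y| <= M,
      forall x y, k x y = k y x
    & forall m (a : 'I_m -> R) (x : 'I_m -> X),
        0 <= \sum_i \sum_j a i * a j * k (x i) (x j)].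

Definition c0_kernel k : Prop :=
  is_kernel k /\
  forall e y, 0 < e -> compact [set x : X | e <= `|k x y|].

Definition mean_embedding k (xi : {charge set (borel X) -> \bar R}) : X -> R :=
  fun y => charge_integral xi (fun x => k x y).

(* Charges are compared on measurable sets only, their values elsewhere being
   irrelevant. *)
Definition c0_universal k : Prop :=
  c0_kernel k /\
  forall xi1 xi2 : {charge set (borel X) -> \bar R},
    mean_embedding k xi1 = mean_embedding k xi2 ->
    forall A, measurable A -> xi1 A = xi2 A.

(* A kernel has exactly one such space: the axioms determine the carrier, and
   the inner product on it. The inner product is unspecified outside the
   carrier. *)
Record rkhs k := RKHS {
  carrier : set (X -> R) ;
  inner : (X -> R) -> (X -> R) -> R ;
  rkhs0 : carrier (fun=> 0) ;
  rkhs_lin : forall a f g, carrier f -> carrier g ->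
    carrier (fun x => a * f x + g x) ;
  innerC : forall f g, carrier f -> carrier g -> inner f g = inner g f ;
  inner_lin : forall a f g h, carrier f -> carrier g -> carrier h ->
    inner (fun x => a * f x + g x) h = a * inner f h + inner g h ;
  inner_ge0 : forall f, carrier f -> 0 <= inner f f ;
  inner_eq0 : forall f, carrier f -> inner f f = 0 -> f = (fun=> 0) ;
  rkhs_complete : forall u : nat -> X -> R, (forall n, carrier (u n)) ->
    (forall e, 0 < e -> exists N, forall m n, (N <= m)%N -> (N <= n)%N ->
       Num.sqrt (inner (u m \- u n) (u m \- u n)) < e) ->
    exists2 f, carrier f &
      Num.sqrt (inner (u n \- f) (u n \- f)) @[n --> \oo] --> (0 : R) ;
  rkhs_section : forall x, carrier (k^~ x) ;
  reproducing : forall f x, carrier f -> inner f (k^~ x) = f x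
}.

End kernel_embedding.

Definition random_embedding {R : realType} {X : completePseudoMetricType R}
    (k : X -> X -> R) {d} {Omega : measurableType d}
    (P : {mfun Omega >-> pprobability (borel X) R}) (w : Omega) : X -> R :=
  mean_embedding k (charge_of_finite_measure (realization P w)).

Section kernel_correlation.
Context {R : realType} {X : completePseudoMetricType R} {k : X -> X -> R}
  (H : rkhs k) {d} {Omega : measurableType d} (Pr : probability Omega R).

(* The expectation of an H-valued random element, in the weak sense. *)
Definition is_weak_expectation (V : Omega -> X -> R) (m : X -> R) : Prop :=
  [/\ carrier H m, forall w, carrier H (V w)
    & forall h, carrier H h ->
        Pr.-integrable [set: Omega] (fun w => (inner H h (V w))%:E) /\
        (inner H h m)%:E = 'E_Pr[fun w => inner H h (V w)]%E].

Definition weak_expectation (V : Omega -> X -> R) : X -> R :=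
  xget (fun=> 0) [set m | is_weak_expectation V m].

Definition kcov (P1 P2 : {RV Pr >-> pprobability (borel X) R}) : R :=
  let V1 := random_embedding k P1 in
  let V2 := random_embedding k P2 in
  fine 'E_Pr[(fun w => inner H (V1 w \- weak_expectation V1)
                              (V2 w \- weak_expectation V2))%R]%E.

Definition kvar (P : {RV Pr >-> pprobability (borel X) R}) : R := kcov P P.

(* If a variance vanishes, where the correlation is undefined, the convention
   x / 0 = 0 makes it 0, in particular different from 1. *)
Definition kcorr (P1 P2 : {RV Pr >-> pprobability (borel X) R}) : R :=
  kcov P1 P2 / (Num.sqrt (kvar P1) * Num.sqrt (kvar P2)).

End kernel_correlation.
Arguments weak_expectation {R X k} H {d Omega} Pr V.
Arguments kcov {R X k} H {d Omega} Pr P1 P2.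
Arguments kvar {R X k} H {d Omega} Pr P.
Arguments kcorr {R X k} H {d Omega} Pr P1 P2.

(* Main.v *)
Require Import Defs.
From HB Require Import structures.
From mathcomp Require Import all_boot all_order all_algebra.
From mathcomp Require Import all_classical all_reals all_analysis.
From mathcomp Require Import measurable_realfun measurable_structure random_variable giry.
From mathcomp Require Import ring lra.

(* Write V_i for the embedding of P_i, m_i for its expectation, which is the
   embedding of the mean measure Q_i, and s_i for the square root of the kernel
   variance. Correlation 1 means E |s_2 (V_1 - m_1) - s_1 (V_2 - m_2)|^2 = 0, so
   that almost surely s_2 P_1 + s_1 Q_2 and s_2 Q_1 + s_1 P_2 have the same
   embedding, hence coincide by universality. Removing a countable set carrying
   both P_1 and P_2, which is null for Q_1 and Q_2, gives s_1 Q_2 = s_2 Q_1; thus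
   s_1 = s_2 by total mass, and P_1 = P_2. Conversely, the variance is positive:
   otherwise P_1 = Q_1 would be both discrete and atomless. *)

Set Implicit Arguments.
Unset Strict Implicit.
Unset Printing Implicit Defensive.

Import Order.TTheory GRing.Theory Num.Theory.
Import numFieldNormedType.Exports.

Local Open Scope classical_set_scope.
Local Open Scope ring_scope.

(** * Inner product geometry of the space, up to Riesz representation *)

Section rkhs_geometry.
Context {R : realType} {X : completePseudoMetricType R} {k : X -> X -> R}.
Variable H : rkhs k.
Implicit Types (f g h : X -> R) (a b : R) (S : set (X -> R)).

Definition normsq f : R := inner H f f.

Lemma carrierB f g : carrier H f -> carrier H g -> carrier H (f \- g).
Proof.
move=> Hf Hg; rewrite (_ : _ \- _ = fun x => -1 * g x + f x).
  exact: rkhs_lin.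
by apply/funext => x /=; ring.
Qed.

Lemma innerBl f g h : carrier H f -> carrier H g -> carrier H h ->
  inner H (f \- g) h = inner H f h - inner H g h.
Proof.
move=> Hf Hg Hh; rewrite (_ : f \- g = fun x => -1 * g x + f x).
  by rewrite inner_lin//; ring.
by apply/funext => x /=; ring.
Qed.

Lemma innerBr f g h : carrier H f -> carrier H g -> carrier H h ->
  inner H h (f \- g) = inner H h f - inner H h g.
Proof.
move=> Hf Hg Hh.
rewrite innerC//; last exact: carrierB.
by rewrite innerBl// !(innerC (f := h)).
Qed.

Lemma inner_BB f f' g g' :
  carrier H f -> carrier H f' -> carrier H g -> carrier H g' ->
  inner H (f \- f') (g \- g') =
  inner H f g - inner H g' f - (inner H f' g - inner H f' g').
Proof.
move=> Hf Hf' Hg Hg'; have HB := carrierB Hg Hg'.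
by rewrite innerBl// !innerBr// (innerC Hf Hg').
Qed.

Lemma inner_linr a f g h : carrier H f -> carrier H g -> carrier H h ->
  inner H h (fun x => a * f x + g x) = a * inner H h f + inner H h g.
Proof.
move=> Hf Hg Hh.
rewrite innerC//; last exact: rkhs_lin.
by rewrite inner_lin// !(innerC (f := h)).
Qed.

Lemma normsq_lin a f g : carrier H f -> carrier H g ->
  normsq (fun x => a * f x + g x) =
  a ^+ 2 * normsq f + 2 * a * inner H f g + normsq g.
Proof.
move=> Hf Hg; have Hfg := rkhs_lin (r := H) a Hf Hg.
by rewrite /normsq inner_lin// !inner_linr// (innerC (f := g) (g := f))//; ring.
Qed.

Lemma carrierZ a f : carrier H f -> carrier H (fun x => a * f x).
Proof.
move=> Hf; rewrite (_ : (fun x => _) = fun x => a * f x + 0).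
  exact: (rkhs_lin (r := H) a Hf (rkhs0 H)).
by apply/funext => x; rewrite addr0.
Qed.

Lemma innerZ a f g : carrier H f -> carrier H g ->
  inner H (fun x => a * f x) g = a * inner H f g.
Proof.
move=> Hf Hg; have H0 := rkhs0 H.
have in0 : inner H (fun=> 0) g = 0.
  have := inner_lin 1 H0 H0 Hg.
  rewrite (_ : (fun x : X => _) = fun=> 0); first lra.
  by apply/funext => x; rewrite mul1r addr0.
have := inner_lin a Hf H0 Hg; rewrite in0 addr0 => <-.
by congr inner; apply/funext => x; rewrite addr0.
Qed.

Lemma normsqB_scale a b f g : carrier H f -> carrier H g ->
  normsq (fun x => a * f x - b * g x) =
  a ^+ 2 * normsq f - 2 * a * b * inner H f g + b ^+ 2 * normsq g.
Proof.
move=> Hf Hg; have Hag := carrierZ (- b) Hg.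
rewrite (_ : (fun x => _) = (fun x => a * f x + - b * g x)); last first.
  by apply/funext => x; ring.
rewrite normsq_lin// (innerC Hf Hag) /normsq !innerZ// (innerC Hg Hag) innerZ//.
by rewrite (innerC Hg Hf); ring.
Qed.

Lemma normsqB f g : carrier H f -> carrier H g ->
  normsq (f \- g) = normsq f - 2 * inner H f g + normsq g.
Proof.
move=> Hf Hg; have Hfg := carrierB Hf Hg.
by rewrite /normsq innerBl// !innerBr// (innerC (f := g) (g := f))//; ring.
Qed.

(** For positive [A] the quadratic is tested at its minimiser [- B / A]. For [A = 0] it is affine in
    [t], and a nonzero [B] would let it reach the value -1. *)
Lemma discriminant_le0 (A B C : R) : 0 <= A ->
  (forall t, 0 <= t ^+ 2 * A + 2 * t * B + C) -> B ^+ 2 <= A * C.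
Proof.
move=> A0 h; have [A_eq0|An0] := eqVneq A 0.
  rewrite A_eq0 mul0r; have [->|Bn0] := eqVneq B 0; first by rewrite expr0n.
  have := h (- (C + 1) / (2 * B)); rewrite A_eq0.
  rewrite (_ : _ + C = -1); first by rewrite oppr_ge0 ler10.
  by field.
have A_gt0 : 0 < A by rewrite lt_neqAle eq_sym An0.
have := h (- B / A); rewrite (_ : _ + C = (A * C - B ^+ 2) / A); last by field.
by rewrite pmulr_lge0 ?invr_gt0// subr_ge0.
Qed.

Lemma inner_CauchySchwarz f g : carrier H f -> carrier H g ->
  inner H f g ^+ 2 <= normsq f * normsq g.
Proof.
move=> Hf Hg; apply: discriminant_le0; first exact: inner_ge0.
by move=> t; rewrite -normsq_lin//; apply: inner_ge0; exact: rkhs_lin.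
Qed.

Definition subspace S : Prop :=
  [/\ S `<=` carrier H, S (fun=> 0) &
      forall a f g, S f -> S g -> S (fun x => a * f x + g x)].

Definition norm_closed S : Prop := forall (u : nat -> X -> R) f,
  (forall n, S (u n)) -> carrier H f ->
  (normsq (u n \- f) @[n --> \oo] --> (0 : R)) -> S f.

(* Riesz representation, obtained by minimising [normsq f - 2 * L f]. *)
Lemma riesz S (L : (X -> R) -> R) (C : R) : subspace S -> norm_closed S ->
  (forall a f g, S f -> S g -> L (fun x => a * f x + g x) = a * L f + L g) ->
  (forall f, S f -> L f ^+ 2 <= C * normsq f) ->
  exists2 f, S f & forall h, S h -> inner H h f = L h.
Proof.
move=> [SH S0 Slin] Scl Llin Lbnd.
pose J f := normsq f - 2 * L f.
have N0 f : S f -> 0 <= normsq f by move=> /SH; exact: inner_ge0.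
(* The bound on [L] and the inequality between arithmetic and geometric means give 2 L f <=
   [normsq f] + |C|. The absolute value is there because [C] has no assumed sign. *)
have J_lb f : S f -> - `|C| <= J f.
  move=> Sf; have := Lbnd _ Sf; have := N0 _ Sf; rewrite /J.
  set N := normsq f; set l := L f => N_ge0 lC.
  have C0 : 0 <= `|C| by [].
  have {}lC : l ^+ 2 <= `|C| * N.
    by apply: le_trans lC _; rewrite ler_wpM2r// ler_norm.
  suff : 2 * l <= N + `|C| by lra.
  have [l0|l0] := leP l 0; first by lra.
  rewrite -(@ler_pXn2r _ 2)// ?nnegrE; try lra.
  have := sqr_ge0 (N - `|C|); move: lC; set c := `|C| => lC; nra.
have Jlin t f g : S f -> S g -> J (fun x => t * f x + g x) =
    J g + t ^+ 2 * normsq f + 2 * t * (inner H f g - L f).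
  move=> Sf Sg; rewrite /J (normsq_lin t (SH _ Sf) (SH _ Sg)) Llin//.
  by ring.
pose j := inf (J @` S).
have J_inf : has_inf (J @` S).
  split; first by exists (J (fun=> 0)), (fun=> 0).
  by exists (- `|C|) => _ [f Sf <-]; exact: J_lb.
have jJ f : S f -> j <= J f.
  by move=> Sf; apply: ge_inf; [exact: J_inf.2|exists f].
have /choice[u uP] : forall n : nat, exists f, S f /\ J f < j + n.+1%:R^-1.
  move=> n; have n0 : (0 : R) < n.+1%:R^-1 by [].
  have [_ [f Sf <-] fj] := inf_adherent n0 J_inf.
  by exists f.
(* Parallelogram argument: the midpoint of [u m] and [u n] lies in [S], so [J] is at least [j]
   there, while both endpoints are nearly minimal. *)
have mid m n : normsq (u m \- u n) <= 2 * (m.+1%:R^-1 + n.+1%:R^-1).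
  have [[Sm Jm] [Sn Jn]] := (uP m, uP n).
  have SB : S (u m \- u n).
    rewrite (_ : _ \- _ = fun x => -1 * u n x + u m x); first exact: Slin.
    by apply/funext => x /=; ring.
  have LB : L (u m \- u n) = L (u m) - L (u n).
    rewrite (_ : _ \- _ = fun x => -1 * u n x + u m x).
      by rewrite Llin//; ring.
    by apply/funext => x /=; ring.
  have := jJ _ (Slin (2^-1) _ _ SB Sn); rewrite Jlin// LB.
  rewrite innerBl; try exact: SH.
  move: Jm Jn; rewrite /J (normsqB (SH _ Sm) (SH _ Sn)) -/(normsq (u n)).
  rewrite (_ : 2^-1 ^+ 2 = 4^-1 :> R) ?divff//; last by field.
  by move: m.+1%:R^-1 n.+1%:R^-1 => p q; lra.
(* Approximate first variation: [J] stays above [j] on the line through [u n] in the direction [h],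
   so the discriminant of [J - j] along this line is controlled by the gap [J (u n) - j]. *)
have var n h : S h -> (inner H h (u n) - L h) ^+ 2 <= normsq h * n.+1%:R^-1.
  move=> Sh; have [Sn Jn] := uP n.
  apply: (@le_trans _ _ (normsq h * (J (u n) - j))).
    apply: discriminant_le0; first exact: N0.
    move=> t; have := jJ _ (Slin t _ _ Sh Sn); rewrite Jlin//; lra.
  by rewrite ler_wpM2l ?N0// lerBlDl ltW.
have [||f Hf uf] := @rkhs_complete _ _ _ H u.
- by move=> n; apply: SH; exact: (uP n).1.
(* For indices beyond [N], [mid] bounds the squared distance by 4 / (N + 1), whence the threshold
   [e ^+ 2 / 4]. *)
- move=> e e0; have [N _ /(_ N (leqnn N))] : \forall n \near \oo, (n.+1%:R^-1 : R) < e ^+ 2 / 4.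
    by apply: (cvgr_lt 0 (@cvg_harmonic R)); rewrite divr_gt0// exprn_gt0.
  rewrite /= => Ne; exists N => m n Nm Nn.
  rewrite -(@ltr_pXn2r _ 2)// ?nnegrE ?sqrtr_ge0// ?ltW//.
  rewrite sqr_sqrtr; last by apply: inner_ge0; apply: carrierB; apply: SH; exact: (uP _).1.
  have inv p : (N <= p)%N -> (p.+1%:R^-1 : R) <= N.+1%:R^-1.
    by move=> Np; rewrite lef_pV2 ?posrE// ler_nat.
  apply: le_lt_trans (mid m n) _; have := inv _ Nm; have := inv _ Nn.
  move: Ne; move: m.+1%:R^-1 n.+1%:R^-1 N.+1%:R^-1 => p q r; lra.
have Hu n : carrier H (u n) by apply: SH; exact: (uP n).1.
have nuf : normsq (u n \- f) @[n --> \oo] --> (0 : R).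
  rewrite (_ : (fun n => _) =
      (fun n => Num.sqrt (normsq (u n \- f)) * Num.sqrt (normsq (u n \- f)))).
    by rewrite -(mul0r 0); exact: (cvgM uf uf).
  apply/funext => n; rewrite -expr2 sqr_sqrtr//.
  by apply: inner_ge0; exact: carrierB.
have Sf : S f by apply: (Scl u) => // n; exact: (uP n).1.
exists f => // h Sh; apply/eqP; rewrite -subr_eq0 -sqrf_eq0 eq_le sqr_ge0 andbT.
(* Passing through [inner H h (u n)], the square to be bounded is at most twice the sum of two
   squares, one controlled by [var] and the other by Cauchy-Schwarz. This null sequence is the
   resulting bound. *)
have bcvg : 2 * normsq h * (normsq (u n \- f) + n.+1%:R^-1) @[n --> \oo] --> (0 : R).
  rewrite (_ : (0 : R) = 2 * normsq h * (0 + 0)); last by rewrite addr0 mulr0.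
  by apply: cvgM; [exact: cvg_cst|apply: cvgD => //; exact: cvg_harmonic].
rewrite -(cvg_lim _ bcvg)//; apply: limr_ge; first by apply/cvg_ex; exists 0.
apply: nearW => n /=.
have Hh := SH _ Sh.
have := inner_CauchySchwarz Hh (carrierB (Hu n) Hf); rewrite innerBr//.
have := var n h Sh.
set a := inner H h f; set b := inner H h (u n); set N := normsq h.
set q := normsq _; set p := _^-1 => v1 v2.
have : 0 <= ((b - L h) + (b - a)) ^+ 2 by exact: sqr_ge0.
by nra.
Qed.

End rkhs_geometry.

(** * Integration against finite measures, their multiples and their sums *)

Section finite_measures.
Context {d} {T : measurableType d} {R : realType}.
Implicit Types (mu nu : {finite_measure set T -> \bar R}) (f : T -> R).

Lemma integrable_bounded mu f (M : R) : measurable_fun [set: T] f ->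
  (forall x, `|f x| <= M) -> mu.-integrable [set: T] (EFin \o f).
Proof.
move=> mf fM; apply: (le_integrable measurableT (g := cst M%:E)).
- exact/measurable_EFinP.
- by move=> x _; rewrite /= lee_fin (le_trans (fM x))// ler_norm.
- exact: finite_measure_integrable_cst.
Qed.

(** The negative set of any Hahn decomposition of a measure is null, so the negative Jordan part
    vanishes and the positive one is [mu] itself. *)
Lemma charge_integral_finite_measure mu f :
  charge_integral (charge_of_finite_measure mu) f = \int[mu]_x f x.
Proof.
rewrite /charge_integral; case: cid => -[P N] /= PN.
have [[mP posP] [mN negN] PNT PN0] := PN.
have muN0 : mu N = 0%E.
  by apply/eqP; rewrite eq_le measure_ge0 andbT; exact: negN.
have muAN0 (A : set T) : measurable A -> mu (A `&` N) = 0%E.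
  move=> mA; apply/eqP; rewrite eq_le measure_ge0 andbT -muN0 le_measure ?inE//.
  exact: measurableI.
have negE (A : set T) : measurable A -> jordan_neg PN A = mzero A.
  move=> mA; rewrite jordan_negE cjordan_negE /crestr0 mem_set// /crestr/=.
  by rewrite /charge_of_finite_measure muAN0// oppe0.
have posE (A : set T) : measurable A -> jordan_pos PN A = mu A.
  move=> mA; rewrite jordan_posE cjordan_posE /crestr0 mem_set// /crestr/=.
  rewrite /charge_of_finite_measure.
  rewrite -[in RHS](setIT A) -PNT setIUr measureU//; [|exact: measurableI..|].
    by rewrite [X in (_ + X)%E]muAN0// adde0.
  by rewrite setIACA PN0 setI0.
rewrite /Rintegral (eq_measure_integral mu); last by move=> A mA _; exact: posE.
rewrite [X in _ - fine X](eq_measure_integral mzero).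
  by rewrite integral_measure_zero subr0.
by move=> A mA _; exact: negE.
Qed.

Lemma Rintegral_mscale (r : {nonneg R}) mu f : mu.-integrable [set: T] (EFin \o f) ->
  \int[mscale r mu]_x f x = r%:num * \int[mu]_x f x.
Proof.
move=> intf; have mf := measurable_int _ intf.
rewrite /Rintegral [in LHS]integralE !ge0_integral_mscale//.
- rewrite -muleBr//.
    by rewrite -integralE fineM//; exact: integrable_fin_num.
  rewrite fin_num_adde_defl// fin_numN.
  by apply: integrable_fin_num => //; exact: integrable_funeneg.
- exact: measurable_funeneg.
- exact: measurable_funepos.
Qed.

End finite_measures.

Section finite_measure_add.
Context {d} {T : measurableType d} {R : realType}.
Variables (mu nu : {finite_measure set T -> \bar R}).

HB.instance Definition _ := Measure.on (measure_add mu nu).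

(** Finiteness allows the sum to be turned into a charge, the form in which universality is
    stated. *)
Let finite_measure_add : fin_num_fun (measure_add mu nu).
Proof.
by move=> A mA; rewrite measure_addE fin_numD !fin_num_measure.
Qed.

HB.instance Definition _ :=
  @Measure_isFinite.Build _ _ _ (measure_add mu nu) finite_measure_add.

Lemma Rintegral_measure_add (f : T -> R) :
  mu.-integrable [set: T] (EFin \o f) -> nu.-integrable [set: T] (EFin \o f) ->
  \int[measure_add mu nu]_x f x = \int[mu]_x f x + \int[nu]_x f x.
Proof.
move=> imu inu.
rewrite /Rintegral (integral_measure_add measurableT imu inu).
by rewrite fineD//; exact: integrable_fin_num.
Qed.
End finite_measure_add.

Lemma normr_Rintegral_le {d} {T : measurableType d} {R : realType}
    (P : probability T R) (f : T -> R) (M : R) :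
  measurable_fun [set: T] f -> (forall x, `|f x| <= M) ->
  `|\int[P]_x f x| <= M.
Proof.
move=> mf fM; have intf := integrable_bounded P mf fM.
apply: le_trans (le_normr_Rintegral measurableT intf) _.
apply: (@le_trans _ _ (\int[P]_(x in setT) (cst M x))).
  apply: le_Rintegral => //.
    exact: (integrable_norm intf).
  exact: finite_measure_integrable_cst.
rewrite Rintegral_cst// (_ : fine _ = 1) ?mulr1//.
exact: (congr1 fine (probability_setT P)).
Qed.

(** * Regularity of the elements of the space, and embeddings of probabilities *)

Section rkhs_elements.
Context {R : realType} {X : completePseudoMetricType R} {k : X -> X -> R}.
Variable H : rkhs k.
Hypothesis kk : is_kernel k.
Implicit Types (f g h : X -> R).

Lemma measurable_section (y : X) :
  measurable_fun [set: borel X] (k^~ y : borel X -> R).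
Proof.
have [mk _ _ _] := kk.
exact: (measurableT_comp mk (measurable_fun_pair (@measurable_id _ (borel X) setT)
   (measurable_cst (y : borel X)))).
Qed.

Lemma normsq_ge0 f : carrier H f -> 0 <= normsq H f.
Proof. exact: inner_ge0. Qed.

(** Cauchy-Schwarz against the section at [x], whose squared norm is [k x x] by the reproducing
    property; [K] comes from the bound on the kernel. *)
Lemma eval_bound : exists2 K : R, 0 <= K &
  forall f, carrier H f -> forall x, f x ^+ 2 <= K * normsq H f.
Proof.
have [_ [M kM] _ _] := kk; exists `|M| => // f Hf x.
rewrite -(reproducing x Hf).
have Hx := rkhs_section H x.
apply: le_trans (inner_CauchySchwarz Hf Hx) _.
rewrite mulrC ler_wpM2r ?normsq_ge0// /normsq reproducing//.
by rewrite (le_trans (ler_norm _))// (le_trans (kM _ _))// ler_norm.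
Qed.

(** The measurable elements form a closed subspace containing every section. Riesz representation on
    it of the inner product with [f] yields the orthogonal projection [g] of [f]; as [f] and [g]
    have the same inner product with each section, they agree pointwise. *)
Lemma carrier_measurable f : carrier H f ->
  measurable_fun [set: borel X] (f : borel X -> R).
Proof.
move=> Hf.
pose S := [set g | carrier H g /\ measurable_fun [set: borel X] (g : borel X -> R)].
have [K K0 KP] := eval_bound.
have [||||g [Hg mg] gE] := @riesz _ _ _ H S (fun g => inner H g f) (normsq H f).
- split => [g []//||a g h [Hg mg] [Hh mh]].
    by split; [exact: rkhs0|exact: measurable_cst].
  split; first exact: rkhs_lin.
  apply: measurable_funD => //; apply: measurable_funM => //.
(* Closedness: by [eval_bound], norm convergence implies pointwise convergence, which preserves
   measurability. *)
- move=> u g Su Hg ug; split=> //.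
  apply: (@measurable_fun_cvg _ (borel X) _ _ u) => [n|x _]; first exact: (Su n).2.
  have ugx n : (u n x - g x) ^+ 2 <= K * normsq H (u n \- g).
    by apply: (KP (u n \- g)); apply: carrierB => //; exact: (Su n).1.
  apply/cvgrPdist_lt => e e0.
  have Kug : K * normsq H (u n \- g) @[n --> \oo] --> (0 : R).
    by rewrite -(mulr0 K); apply: cvgM => //; exact: cvg_cst.
  have e20 : 0 < e ^+ 2 by rewrite exprn_gt0.
  near=> n; rewrite -(@ltr_pXn2r _ 2)// ?nnegrE// ?ltW//.
  rewrite distrC real_normK ?num_real//; apply: le_lt_trans (ugx n) _.
  by near: n; exact: (cvgr_lt _ Kug).
- by move=> a g h [Hg _] [Hh _]; rewrite inner_lin.
- by move=> g [Hg _]; rewrite mulrC inner_CauchySchwarz.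
suff -> : f = g by [].
apply/funext => x; rewrite -(reproducing x Hf) -(reproducing x Hg).
have Hx := rkhs_section H x.
rewrite [LHS]innerC// [RHS]innerC// gE//; split => //; exact: measurable_section.
Unshelve. all: by end_near. Qed.

Lemma carrier_bounded f : carrier H f -> exists M, forall x, `|f x| <= M.
Proof.
move=> Hf; have [K K0 KP] := eval_bound; exists (Num.sqrt (K * normsq H f)) => x.
by rewrite -sqrtr_sqr ler_sqrt ?mulr_ge0 ?normsq_ge0// KP.
Qed.

Lemma carrier_integrable f (mu : {finite_measure set (borel X) -> \bar R}) :
  carrier H f -> mu.-integrable [set: borel X] (EFin \o f).
Proof.
move=> Hf; have [M fM] := carrier_bounded Hf.
exact: integrable_bounded (carrier_measurable Hf) fM.
Qed.

Definition embedding (P : probability (borel X) R) : X -> R :=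
  mean_embedding k (charge_of_finite_measure P).

Lemma embeddingE P y : embedding P y = \int[P]_x k x y.
Proof. exact: charge_integral_finite_measure. Qed.

(** By [eval_bound], integration against [P] is a bounded functional on the whole space. Pairing its
    Riesz representer with the sections identifies it with the embedding. *)
Lemma embeddingP P : carrier H (embedding P) /\
  forall h, carrier H h -> inner H h (embedding P) = \int[P]_x h x.
Proof.
have [K K0 KP] := eval_bound.
have [||||g Hg gE] := @riesz _ _ _ H (carrier H) (fun g => \int[P]_x g x) K.
- by split => //; [exact: rkhs0|move=> a f g; exact: rkhs_lin].
- by [].
- move=> a f g Hf Hg; rewrite RintegralD//.
  + by rewrite RintegralZl//; exact: carrier_integrable.
  + have [M fM] := carrier_bounded Hf.
    apply: (@integrable_bounded _ _ _ _ _ (`|a| * M)).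
      by apply: measurable_funM => //; exact: carrier_measurable.
    by move=> x; rewrite normrM ler_wpM2l.
  + exact: carrier_integrable.
- move=> f Hf; have KN : 0 <= K * normsq H f by rewrite mulr_ge0 ?normsq_ge0.
  rewrite -(sqr_sqrtr KN) -real_normK ?num_real//.
  rewrite ler_pXn2r// ?nnegrE ?sqrtr_ge0//.
  apply: normr_Rintegral_le; first exact: carrier_measurable.
  by move=> x; rewrite -sqrtr_sqr ler_sqrt// KP.
suff -> : embedding P = g by [].
apply/funext => y; rewrite embeddingE -(reproducing y Hg).
have Hy := rkhs_section H y.
by rewrite innerC// gE.
Qed.

End rkhs_elements.
Arguments embedding {R X} k P.

(** Adding [M] makes the integrand nonnegative, which is the case covered by measurability of
    integrals along a kernel; each [Q z] has mass 1, so the integral is shifted by exactly [M]. *)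
Lemma measurable_Rintegral_kernel {d d'} {Z : measurableType d}
    {T : measurableType d'} {R : realType} (Q : Z -> pprobability T R)
    (F : Z * T -> R) (M : R) :
  measurable_fun [set: Z] Q -> measurable_fun [set: Z * T] F ->
  (forall z, `|F z| <= M) ->
  measurable_fun [set: Z] (fun z => \int[(Q z : probability T R)]_x F (z, x)).
Proof.
move=> mQ mF FM.
have mFz z : measurable_fun [set: T] (fun x => F (z, x)).
  exact: measurableT_comp mF (measurable_pair1 z).
rewrite (_ : (fun z => _) = (fun z =>
    \int[(Q z : probability T R)]_x (F (z, x) + M) - M)).
  apply: measurable_funB => //; apply: measurableT_comp => //.
  have := @measurable_fun_integral_finite_kernel _ _ _ _ _
    (fun z => (F z + M)%:E) (kprobability mQ).
  apply.
    by move=> z; rewrite lee_fin -lerBlDr sub0r; have := FM z; rewrite ler_norml => /andP[].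
  by apply/measurable_EFinP; exact: measurable_funD.
apply/funext => z; rewrite RintegralD//.
- rewrite Rintegral_cst// (_ : fine _ = 1) ?mulr1 ?addrK//.
  exact: (congr1 fine (probability_setT (Q z))).
- exact: (integrable_bounded _ (mFz z) (fun x => FM (z, x))).
- exact: finite_measure_integrable_cst.
Qed.

(** The vanishing quadratic expression is the integral of the squared norm of [a * U - b * V], which
    is therefore zero almost surely. Definiteness of the inner product gives all points [x] at once,
    off a single null set. *)
Lemma ae_proportional {R : realType} {X : completePseudoMetricType R}
    {k : X -> X -> R} {H : rkhs k} {d} {Omega : measurableType d}
    (Pr : probability Omega R) (U V : Omega -> X -> R) (a b u c v : R) :
  (forall w, carrier H (U w)) -> (forall w, carrier H (V w)) ->
  Pr.-integrable [set: Omega] (fun w => (inner H (U w) (U w))%:E) ->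
  Pr.-integrable [set: Omega] (fun w => (inner H (U w) (V w))%:E) ->
  Pr.-integrable [set: Omega] (fun w => (inner H (V w) (V w))%:E) ->
  u = \int[Pr]_w inner H (U w) (U w) ->
  c = \int[Pr]_w inner H (U w) (V w) ->
  v = \int[Pr]_w inner H (V w) (V w) ->
  a ^+ 2 * u - 2 * a * b * c + b ^+ 2 * v = 0 ->
  {ae Pr, forall w x, a * U w x = b * V w x}.
Proof.
move=> HU HV iUU iUV iVV uE cE vE E0.
pose D w x := a * U w x - b * V w x.
have HD w : carrier H (D w).
  exact: (carrierB (carrierZ a (HU w)) (carrierZ b (HV w))).
have iZ (r : R) (f : Omega -> R) : Pr.-integrable [set: Omega] (EFin \o f) ->
    Pr.-integrable [set: Omega] (EFin \o (fun w => r * f w)).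
  exact: (integrableZl measurableT r).
have iB : Pr.-integrable [set: Omega] (EFin \o (fun w =>
    a ^+ 2 * inner H (U w) (U w) - 2 * a * b * inner H (U w) (V w))).
  exact: (integrableB measurableT (iZ _ _ iUU) (iZ _ _ iUV)).
have DE : (fun w => normsq H (D w)) = (fun w => a ^+ 2 * inner H (U w) (U w) -
    2 * a * b * inner H (U w) (V w) + b ^+ 2 * inner H (V w) (V w)).
  by apply/funext => w; exact: normsqB_scale.
have iD : Pr.-integrable [set: Omega] (EFin \o (fun w => normsq H (D w))).
  rewrite DE; exact: (integrableD measurableT iB (iZ _ _ iVV)).
have D0 : \int[Pr]_w normsq H (D w) = 0.
  rewrite DE (RintegralD measurableT iB (iZ _ _ iVV)).
  rewrite (RintegralB measurableT (iZ _ _ iUU) (iZ _ _ iUV)).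
  rewrite (RintegralZl _ measurableT iUU) (RintegralZl _ measurableT iUV).
  by rewrite (RintegralZl _ measurableT iVV) -uE -cE -vE.
have : (\int[Pr]_w `|(normsq H (D w))%:E| = 0)%E.
  under eq_integral => w _ do rewrite gee0_abs ?lee_fin ?normsq_ge0//.
  by rewrite -[LHS]fineK ?integrable_fin_num//; congr EFin.
move=> /(ae_eq_integral_abs _ measurableT (measurable_int _ iD)).
apply: filterS => w /(_ I)[Dw] x.
have := congr1 (@^~ x) (inner_eq0 (HD w) Dw).
by rewrite /D => /eqP; rewrite subr_eq0 => /eqP.
Qed.

(** * Random embeddings, their expectation and their kernel covariance *)

Section random_embedding.
Context {R : realType} {X : completePseudoMetricType R} {k : X -> X -> R}.
Variable H : rkhs k.
Hypothesis kk : is_kernel k.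
Context {d} {Omega : measurableType d} (Pr : probability Omega R).
Implicit Types P : {RV Pr >-> pprobability (borel X) R}.

Lemma random_embeddingE P w :
  random_embedding k P w = embedding k (realization P w).
Proof. by []. Qed.

(** Explicit form of the expectation of the random embedding; see [weak_expectation_embedding]. *)
Definition mean_embed P : X -> R := embedding k (mean_measure Pr P).

Definition centered P w : X -> R := random_embedding k P w \- mean_embed P.

Lemma carrier_random_embedding P w : carrier H (random_embedding k P w).
Proof. exact: (embeddingP H kk _).1. Qed.

Lemma carrier_mean_embed P : carrier H (mean_embed P).
Proof. exact: (embeddingP H kk _).1. Qed.

Lemma carrier_centered P w : carrier H (centered P w).
Proof. exact: (carrierB (carrier_random_embedding _ _) (carrier_mean_embed _)). Qed.

Lemma inner_random_embedding P w h : carrier H h ->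
  inner H h (random_embedding k P w) = \int[realization P w]_x h x.
Proof. exact: (embeddingP H kk _).2. Qed.

Lemma measurable_inner_embedding P h : carrier H h ->
  measurable_fun [set: Omega] (fun w => inner H h (random_embedding k P w)).
Proof.
move=> Hh; have [M hM] := carrier_bounded kk Hh.
rewrite (_ : (fun w => _) = (fun w => \int[realization P w]_x h x)).
  apply: (@measurable_Rintegral_kernel _ _ _ _ _ P (fun z => h z.2) M) => //.
  exact: measurableT_comp (carrier_measurable kk Hh) measurable_snd.
by apply/funext => w; exact: inner_random_embedding.
Qed.

Lemma integrable_inner_embedding P h : carrier H h ->
  Pr.-integrable [set: Omega] (fun w => (inner H h (random_embedding k P w))%:E).
Proof.
move=> Hh; have [M hM] := carrier_bounded kk Hh.
apply: (@integrable_bounded _ _ _ Pr _ M).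
  exact: measurable_inner_embedding.
move=> w; rewrite inner_random_embedding//; apply: normr_Rintegral_le => //.
exact: (carrier_measurable kk Hh).
Qed.

(** Testing against [h] reduces existence to the formula for integrals against the mean measure. For
    uniqueness, two candidates are tested against their own difference. *)
Lemma weak_expectation_embedding P :
  weak_expectation H Pr (random_embedding k P) = mean_embed P.
Proof.
rewrite /weak_expectation; apply: xget_subset1.
  split; [exact: carrier_mean_embed|exact: carrier_random_embedding|].
  move=> h Hh; split; first exact: integrable_inner_embedding.
  rewrite (embeddingP H kk _).2//.
  rewrite integral_mean_measure; [|exact: (carrier_measurable kk Hh)|exact: (carrier_bounded kk Hh)].
  rewrite (_ : (fun w => \int[realization P w]_x h x) =
     (fun w => inner H h (random_embedding k P w))); last first.
    by apply/funext => w; rewrite inner_random_embedding.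
  by rewrite fineK// unlock integrable_fin_num//; exact: integrable_inner_embedding.
move=> m m' [Hm _ mE] [Hm' _ m'E]; have Hmm' := carrierB Hm Hm'.
have : inner H (m \- m') (m \- m') = 0.
  apply: EFin_inj; rewrite innerBr// EFinB (mE _ Hmm').2 (m'E _ Hmm').2 subee//.
  by rewrite unlock integrable_fin_num//; exact: (mE _ Hmm').1.
move=> /(inner_eq0 Hmm') mm'; apply/funext => x.
by have /eqP := congr1 (@^~ x) mm'; rewrite /= subr_eq0 => /eqP.
Qed.

Lemma measurable_inner_embeddings P1 P2 : measurable_fun [set: Omega]
  (fun w => inner H (random_embedding k P1 w) (random_embedding k P2 w)).
Proof.
have [mk [M kM] _ _] := kk.
rewrite (_ : (fun w => _) =
    (fun w => \int[realization P2 w]_y random_embedding k P1 w y)); last first.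
  by apply/funext => w; apply: inner_random_embedding; exact: carrier_random_embedding.
apply: (@measurable_Rintegral_kernel _ _ _ _ _ P2
    (fun z => random_embedding k P1 z.1 z.2) M) => //.
  rewrite (_ : (fun z => _) = (fun z => \int[realization P1 z.1]_x k x z.2)); last first.
    by apply/funext => z; rewrite random_embeddingE embeddingE.
  (* Inner of two nested integrals: the parameter is now the pair of the outcome and the point [y],
     while [x] is integrated out. *)
  apply: (@measurable_Rintegral_kernel _ _ (Omega * borel X)%type _ _
     (fun z => P1 z.1) (fun z => k z.2 z.1.2) M) => //.
    exact: measurableT_comp.
  have mp : measurable_fun [set: Omega * borel X * borel X]
      (fun z : Omega * borel X * borel X => (z.2, z.1.2)).
    by apply: measurable_fun_pair => //; exact: measurableT_comp.
  exact: (measurableT_comp mk mp).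
move=> [w y]; rewrite random_embeddingE embeddingE; apply: normr_Rintegral_le => //.
exact: measurable_section.
Qed.

Lemma inner_embeddings_bounded P1 P2 : exists M, forall w,
  `|inner H (random_embedding k P1 w) (random_embedding k P2 w)| <= M.
Proof.
have [mk [M kM] _ _] := kk; exists M => w.
rewrite inner_random_embedding//; last exact: carrier_random_embedding.
apply: normr_Rintegral_le.
  exact: (carrier_measurable kk (carrier_random_embedding _ _)).
move=> y; rewrite random_embeddingE embeddingE; apply: normr_Rintegral_le => //.
exact: measurable_section.
Qed.

Lemma integrable_inner_centered P1 P2 : Pr.-integrable [set: Omega]
  (fun w => (inner H (centered P1 w) (centered P2 w))%:E).
Proof.
have HV P w := carrier_random_embedding P w.
have Hm P := carrier_mean_embed P.
have [M bM] := inner_embeddings_bounded P1 P2.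
(* Bilinear expansion into one product of two random embeddings, two products with a fixed mean, and
   a constant, all bounded in [w]. *)
rewrite (_ : (fun w => _) = (fun w =>
  ((inner H (random_embedding k P1 w) (random_embedding k P2 w))%:E -
  (inner H (mean_embed P2) (random_embedding k P1 w))%:E -
  ((inner H (mean_embed P1) (random_embedding k P2 w))%:E -
  (inner H (mean_embed P1) (mean_embed P2))%:E))%E)).
  apply: integrableB => //; apply: integrableB => //.
  - exact: integrable_bounded (measurable_inner_embeddings _ _) bM.
  - exact: integrable_inner_embedding.
  - exact: integrable_inner_embedding.
  - exact: finite_measure_integrable_cst.
apply/funext => w; rewrite -!EFinB; congr EFin.
exact: (inner_BB (HV P1 w) (Hm P1) (HV P2 w) (Hm P2)).
Qed.

Lemma kcovE P1 P2 :
  kcov H Pr P1 P2 = \int[Pr]_w inner H (centered P1 w) (centered P2 w).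
Proof. by rewrite /kcov !weak_expectation_embedding unlock. Qed.

Lemma kvar_ge0 P : 0 <= kvar H Pr P.
Proof.
rewrite /kvar kcovE; apply: Rintegral_ge0 => w _.
by apply: inner_ge0; exact: carrier_centered.
Qed.

Lemma centered_proportional (a b : R) P1 P2 :
  a ^+ 2 * kvar H Pr P1 - 2 * a * b * kcov H Pr P1 P2 + b ^+ 2 * kvar H Pr P2 = 0 ->
  {ae Pr, forall w x, a * centered P1 w x = b * centered P2 w x}.
Proof.
apply: (ae_proportional (H := H)); [exact: carrier_centered|exact: carrier_centered|
  exact: integrable_inner_centered|exact: integrable_inner_centered|
  exact: integrable_inner_centered|exact: kcovE|exact: kcovE|exact: kcovE].
Qed.

End random_embedding.
Arguments mean_embed {R X} k {d Omega Pr} P.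
Arguments centered {R X} k {d Omega Pr} P w.

(** * Discrete against atomless measures *)

Section countable_null.
Context {d} {T : measurableType d} {R : realType}.
Hypothesis m1 : forall x : T, measurable [set x].

(** A singleton of positive mass would be an atom, its only subsets being itself and the empty
    set. *)
Lemma atomless_set1 (mu : {measure set T -> \bar R}) x :
  atomless mu -> mu [set x] = 0%E.
Proof.
move=> mu_atomless; apply/eqP; rewrite -measure_le0 leNgt; apply/negP => mux.
apply: (mu_atomless [set x]); split => // B mB /subset_set1[->|->].
  by rewrite measure0.
by rewrite ltxx.
Qed.

Lemma atomless_countable (mu : {measure set T -> \bar R}) (C : set T) :
  atomless mu -> countable C -> measurable C -> mu C = 0%E.
Proof.
move=> mu_atomless /countable_injP[f injf] mC; apply: measure_negligible => //.
(* The fibres of the injection [f] into the natural numbers are empty or singletons, hence null. *)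
rewrite (_ : C = \bigcup_n (C `&` f @^-1` [set n])); last first.
  apply/seteqP; split => [x Cx|x [n _ []]//].
  by exists (f x).
apply: negligible_bigcup => n.
have [->|/set0P[x [Cx fx]]] := eqVneq (C `&` f @^-1` [set n]) set0.
  exact: negligible_set0.
apply: (@negligibleS _ _ _ _ [set x]); last first.
  by apply/negligibleP => //; exact: atomless_set1.
by move=> y [Cy fy]; apply: injf; rewrite ?inE//= fx fy.
Qed.

Lemma discrete_atomless_cancel (p1 p2 q1 q2 : probability T R) (a b : R) :
  0 < a -> 0 < b ->
  discrete_measure p1 -> discrete_measure p2 -> atomless q1 -> atomless q2 ->
  (forall A, measurable A ->
     a * fine (p1 A) + b * fine (q2 A) = a * fine (q1 A) + b * fine (p2 A)) ->
  p1 ≡μ p2.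
Proof.
move=> a0 b0 [C1 [cC1 mC1 p10]] [C2 [cC2 mC2 p20]] q1a q2a E.
pose C := C1 `|` C2.
have mC : measurable C by exact: measurableU.
have qC (q : probability T R) : atomless q -> q C = 0%E.
  move=> qa; apply: measure_negligible => //; apply: negligibleU;
  by apply/negligibleP => //; exact: atomless_countable.
have q1C := qC _ q1a; have q2C := qC _ q2a.
have null (mu : probability T R) A B : measurable A -> measurable B ->
    A `<=` B -> mu B = 0%E -> mu A = 0%E.
  by move=> mA mB AB B0; apply: subset_measure0 AB B0.
have p1C A : measurable A -> p1 (A `\` C) = 0%E.
  move=> mA; apply: (null _ _ (~` C1)) => //; [exact: measurableD|exact: measurableC|].
  by move=> x [_ nC] C1x; apply: nC; left.
have p2C A : measurable A -> p2 (A `\` C) = 0%E.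
  move=> mA; apply: (null _ _ (~` C2)) => //; [exact: measurableD|exact: measurableC|].
  by move=> x [_ nC] C2x; apply: nC; right.
have qD (q : probability T R) A : q C = 0%E -> measurable A -> q (A `\` C) = q A.
  move=> qC0 mA; have mAC : measurable (A `&` C) by exact: measurableI.
  rewrite [RHS](measureDI q mA mC).
  by rewrite [X in (_ + X)%E](null _ _ C)// ?adde0//; exact: subIsetr.
(* The discrete terms vanish on the complement of [C], while removing [C] leaves the atomless terms
   unchanged. *)
have Eq A : measurable A -> b * fine (q2 A) = a * fine (q1 A).
  move=> mA; have := E _ (measurableD mA mC).
  by rewrite p1C// p2C// !qD// !mulr0 add0r addr0.
have ab : a = b.
  have := Eq _ measurableT.
  rewrite -[fine (q2 _)]/(fine (q2 setT)) -[fine (q1 _)]/(fine (q1 setT)).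
  have -> : fine (q2 setT) = 1 by exact: (congr1 fine (probability_setT q2)).
  have -> : fine (q1 setT) = 1 by exact: (congr1 fine (probability_setT q1)).
  by rewrite !mulr1.
(* By [Eq] the atomless terms on the two sides are equal and cancel, leaving the discrete ones. *)
move=> A mA; have := E _ mA; rewrite Eq// addrC => /addrI.
rewrite ab => /(mulfI (lt0r_neq0 b0)) EA.
rewrite -[LHS]fineK; last exact: fin_num_measure.
by rewrite -[RHS]fineK ?EA//; exact: fin_num_measure.
Qed.

(** A countable set carrying [p] would be null for [q], hence for [p], which would then have total
    mass zero. *)
Lemma discrete_not_atomless (p q : probability T R) :
  discrete_measure p -> atomless q -> ~ (p ≡μ q).
Proof.
move=> [C [cC mC pC]] qa pq.
have : p setT = 0%E.
  rewrite -(setUv C) measureU//; [|exact: measurableC|by rewrite setICr].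
  have pC0 : p C = 0%E := etrans (pq _ mC) (atomless_countable qa cC mC).
  by rewrite [X in (X + _)%E]pC0 [X in (_ + X)%E]pC adde0.
by rewrite probability_setT => /eqP; rewrite onee_eq0.
Qed.

End countable_null.

(** * Consequences of universality for mixtures of probabilities *)

Section universality.
Context {R : realType} {X : completePseudoMetricType R} {k : X -> X -> R}.
Hypothesis ku : c0_universal k.
Implicit Types p q : probability (borel X) R.

Let kk : is_kernel k. Proof. by have [[]] := ku. Qed.

Lemma integrable_section (mu : {finite_measure set (borel X) -> \bar R}) y :
  mu.-integrable [set: borel X] (EFin \o k^~ y).
Proof.
have [_ [M kM] _ _] := kk.
exact: integrable_bounded (measurable_section kk y) (fun x => kM x y).
Qed.

Lemma embedding_inj p q : embedding k p = embedding k q -> p ≡μ q.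
Proof. exact: ku.2. Qed.

(** Both sides are embeddings of finite positive measures. Keeping the coefficients nonnegative
    allows universality to be applied to charges built from measures, whose integrals are ordinary
    ones. *)
Lemma embedding_mixture_inj (a b : {nonneg R}) p1 p2 q1 q2 :
  (forall y, a%:num * embedding k p1 y + b%:num * embedding k q2 y =
             a%:num * embedding k q1 y + b%:num * embedding k p2 y) ->
  forall A, measurable A ->
    a%:num * fine (p1 A) + b%:num * fine (q2 A) =
    a%:num * fine (q1 A) + b%:num * fine (p2 A).
Proof.
move=> E A mA.
have EA p q : fine (measure_add (mscale a p) (mscale b q) A) =
    a%:num * fine (p A) + b%:num * fine (q A).
  rewrite measure_addE fineD; try by apply: fin_num_measure.
  by rewrite /= /mscale !fineM//; exact: fin_num_measure.
rewrite -!EA; congr fine.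
pose mix p q := charge_of_finite_measure (measure_add (mscale a p) (mscale b q)).
have mixE p q y : mean_embedding k (mix p q) y =
    a%:num * embedding k p y + b%:num * embedding k q y.
  rewrite /mean_embedding charge_integral_finite_measure.
  rewrite Rintegral_measure_add; try exact: integrable_section.
  rewrite !Rintegral_mscale; try exact: integrable_section.
  by rewrite !embeddingE.
apply: (ku.2 (mix p1 q2) (mix q1 p2)) => //.
by apply/funext => y; rewrite !mixE.
Qed.

End universality.

Lemma ae_ex {d} {T : measurableType d} {R : realType} (P : probability T R)
  (Q : T -> Prop) : {ae P, forall w, Q w} -> exists w, Q w.
Proof.
move=> aeQ; have PT : (0 < P setT)%E by rewrite probability_setT lte01.
have := ae_properfilter_algebraOfSetsType PT => pf.
exact: filter_ex aeQ.
Qed.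

Lemma measurable_borel_set1 {R : realType} (X : completePseudoMetricType R) :
  hausdorff_space X -> forall x : borel X, measurable [set x].
Proof.
move=> hX x; rewrite -(setCK [set x]); apply: measurableC.
apply: sub_sigma_algebra; apply: closed_openC.
exact: (accessible_closed_set1 (hausdorff_accessible hX)).
Qed.

(** * Invariance of the kernel covariance under almost sure equality *)

Section almost_sure_equality.
Context {R : realType} {X : completePseudoMetricType R} {k : X -> X -> R}.
Variable H : rkhs k.
Hypothesis kk : is_kernel k.
Context {d} {Omega : measurableType d} (Pr : probability Omega R).
Implicit Types P Q : {RV Pr >-> pprobability (borel X) R}.

Lemma eq_embedding (p q : probability (borel X) R) :
  p ≡μ q -> embedding k p = embedding k q.
Proof.
move=> pq; apply/funext => y; rewrite !embeddingE; congr fine.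
by apply: eq_measure_integral => A mA _; exact: pq.
Qed.

Lemma measurable_evaluation P (A : set (borel X)) : measurable A ->
  measurable_fun [set: Omega] (fun w => realization P w A).
Proof. exact: (measurable_kernel (kprobability (@measurable_funPT _ _ _ _ P))). Qed.

Lemma ae_eq_mean_measure P Q :
  {ae Pr, forall w, realization P w ≡μ realization Q w} ->
  mean_measure Pr P ≡μ mean_measure Pr Q.
Proof.
move=> PQ A mA; apply: ae_eq_integral => //.
- exact: measurable_evaluation.
- exact: measurable_evaluation.
by apply: filterS PQ => w + _; exact.
Qed.

(** Almost sure equality makes the mean measures equal, so the centred embeddings agree almost
    surely. *)
Lemma ae_eq_kcov P P' Q Q' :
  {ae Pr, forall w, realization P w ≡μ realization P' w} ->
  {ae Pr, forall w, realization Q w ≡μ realization Q' w} ->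
  kcov H Pr P Q = kcov H Pr P' Q'.
Proof.
move=> PP QQ.
have ceq P1 P2 : {ae Pr, forall w, realization P1 w ≡μ realization P2 w} ->
    {ae Pr, forall w, centered k P1 w = centered k P2 w}.
  move=> P12; have m12 := eq_embedding (ae_eq_mean_measure P12).
  apply: filterS P12 => w e12.
  exact: (congr2 (fun f g : X -> R => f \- g) (eq_embedding e12) m12).
apply: (etrans (kcovE H kk P Q)); apply: (etrans _ (esym (kcovE H kk P' Q'))).
apply: (congr1 fine).
apply: ae_eq_integral => //.
- exact: measurable_int (integrable_inner_centered H kk P Q).
- exact: measurable_int (integrable_inner_centered H kk P' Q').
apply: filterS2 (ceq _ _ PP) (ceq _ _ QQ) => w eP eQ _.
by rewrite /= eP eQ.
Qed.

End almost_sure_equality.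

(** * Positive variance and the two implications *)

Section correlation_one.
Context {R : realType} {X : completePseudoMetricType R} {k : X -> X -> R}.
Hypotheses (hX : hausdorff_space X) (ku : c0_universal k).
Variable H : rkhs k.
Context {d} {Omega : measurableType d} (Pr : probability Omega R).
Implicit Types P Q : {RV Pr >-> pprobability (borel X) R}.

Let kk : is_kernel k. Proof. by have [[]] := ku. Qed.

Lemma kvar_gt0 P :
  {ae Pr, forall w, discrete_measure (realization P w)} ->
  atomless (mean_measure Pr P) -> 0 < kvar H Pr P.
Proof.
move=> discr mean_atomless; rewrite lt_neqAle kvar_ge0// andbT; apply/eqP => v0.
(* The coefficients 1 and 0 turn a zero variance into an almost surely zero centred embedding. *)
have /(centered_proportional kk) cP : 1 ^+ 2 * kvar H Pr P -
    2 * 1 * 0 * kcov H Pr P P + 0 ^+ 2 * kvar H Pr P = 0.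
  by rewrite -v0; ring.
have [w [discrw cPw]] : exists w, discrete_measure (realization P w) /\
    forall x, 1 * centered k P w x = 0 * centered k P w x.
  by apply: (ae_ex (P := Pr)); apply: filterS2 discr cP => w ? ?; split.
apply: (discrete_not_atomless (measurable_borel_set1 hX) discrw mean_atomless).
apply: (embedding_inj ku); apply/funext => x.
by have := cPw x; rewrite mul1r mul0r => /eqP; rewrite subr_eq0 => /eqP.
Qed.

Lemma kcorr1_ae_eq P1 P2 :
  {ae Pr, forall w, discrete_measure (realization P1 w)} ->
  {ae Pr, forall w, discrete_measure (realization P2 w)} ->
  atomless (mean_measure Pr P1) -> atomless (mean_measure Pr P2) ->
  kcorr H Pr P1 P2 = 1 ->
  {ae Pr, forall w, realization P1 w ≡μ realization P2 w}.
Proof.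
move=> discr1 discr2 atomless1 atomless2.
have v1 := kvar_gt0 discr1 atomless1; have v2 := kvar_gt0 discr2 atomless2.
rewrite /kcorr; set s1 := Num.sqrt _; set s2 := Num.sqrt _.
have s1_gt0 : 0 < s1 by rewrite sqrtr_gt0.
have s2_gt0 : 0 < s2 by rewrite sqrtr_gt0.
move=> /divr1_eq cE.
(* Equality case of Cauchy-Schwarz: as the covariance is [s1 * s2], the crossed coefficients [s2]
   and [s1] make the quadratic expression vanish. *)
have /(centered_proportional kk) prop : s2 ^+ 2 * kvar H Pr P1 -
    2 * s2 * s1 * kcov H Pr P1 P2 + s1 ^+ 2 * kvar H Pr P2 = 0.
  have v1E : kvar H Pr P1 = s1 ^+ 2 := esym (sqr_sqrtr (ltW v1)).
  have v2E : kvar H Pr P2 = s2 ^+ 2 := esym (sqr_sqrtr (ltW v2)).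
  by rewrite cE v1E v2E; ring.
apply: filterS3 discr1 discr2 prop => w d1 d2 prop.
apply: (discrete_atomless_cancel (measurable_borel_set1 hX) s2_gt0 s1_gt0 d1 d2
  atomless1 atomless2).
(* Moving the subtracted means to the opposite sides leaves only nonnegative coefficients. *)
apply: (embedding_mixture_inj ku (a := NngNum (ltW s2_gt0))
  (b := NngNum (ltW s1_gt0))) => y /=.
have := prop y; rewrite /centered /mean_embed random_embeddingE random_embeddingE /=.
move: (embedding k _ y) (embedding k _ y) (embedding k _ y) (embedding k _ y).
by move=> ? ? ? ? ?; lra.
Qed.

(** The covariance and both variances equal [kvar H Pr P1]. Its positivity rules out the quotient 0
    / 0, whose value is 0 by convention. *)
Lemma ae_eq_kcorr1 P1 P2 :
  {ae Pr, forall w, discrete_measure (realization P1 w)} ->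
  atomless (mean_measure Pr P1) ->
  {ae Pr, forall w, realization P1 w ≡μ realization P2 w} ->
  kcorr H Pr P1 P2 = 1.
Proof.
move=> discr1 atomless1 P12; have v1 := kvar_gt0 discr1 atomless1.
have P21 : {ae Pr, forall w, realization P2 w ≡μ realization P1 w}.
  by apply: filterS P12 => w e A mA; rewrite e.
have P11 : {ae Pr, forall w, realization P1 w ≡μ realization P1 w} by apply: aeW.
have c12 : kcov H Pr P1 P2 = kvar H Pr P1 := ae_eq_kcov H kk P11 P21.
have c22 : kvar H Pr P2 = kvar H Pr P1 := ae_eq_kcov H kk P21 P21.
by rewrite /kcorr c12 c22 -expr2 sqr_sqrtr ?ltW// divff// gt_eqF.
Qed.

End correlation_one.

Theorem theorem5 (R : realType) (X : completePseudoMetricType R)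
    (polishX : polish X) (lcX : locally_compact [set: X])
    (k : X -> X -> R) (ku : c0_universal k) (H : rkhs k)
    (d : measure_display) (Omega : measurableType d) (Pr : probability Omega R)
    (P1 P2 : {RV Pr >-> pprobability (borel X) R})
    (discr1 : {ae Pr, forall w, discrete_measure (realization P1 w)})
    (discr2 : {ae Pr, forall w, discrete_measure (realization P2 w)})
    (atomless1 : atomless (mean_measure Pr P1))
    (atomless2 : atomless (mean_measure Pr P2)) :
  kcorr H Pr P1 P2 = 1 <->
  {ae Pr, forall w, realization P1 w ≡μ realization P2 w}.
Proof.
split; first exact: (kcorr1_ae_eq polishX.1 ku).
exact: (ae_eq_kcorr1 polishX.1 ku).
Qed.
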